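(* Let $\mu$ be an infinitely divisible distribution on a complex separable Banach space $E$ with characteristic functional of the form $$\int_E e^{i\mathrm{Re}\langle z,x^*\rangle}\mu(dz)=\exp\Big(-\frac14\langle Rx^*,x^*\rangle+\int_E\int_{-\infty}^\infty\big(e^{iu\mathrm{Re}\langle z,x^*\rangle}-1-iu\kappa(u)\mathrm{Re}\langle z,x^*\rangle\big)\rho(z,du)\,\xi(dz)\Big),\quad x^*\in E^*.$$ For any $p\in[0,2]$ and $c>0$, we have the codifference bounds $$|C_\mu^{=}(x^*,y^* )|\le\frac12|\mathrm{Re}\langle Rx^*,y^*\rangle|+16\int_E\Big(2^{-p}\int_{-c}^c|u|^p|\mathrm{Re}\langle z,x^*\rangle\,\mathrm{Re}\langle z,y^*\rangle|^{p/2}\rho(z,du)+\rho(z,\mathbb{R}\setminus[-c,c])\Big)\xi(dz)$$ and $$|C_\mu^{\neq}(x^*,y^* )|\le\frac12|\mathrm{Im}\langle Rx^*,y^*\rangle|+16\int_E\Big(2^{-p}\int_{-c}^c|u|^p|\mathrm{Re}\langle z,x^*\rangle\,\mathrm{Im}\langle z,y^*\rangle|^{p/2}\rho(z,du)+\rho(z,\mathbb{R}\setminus[-c,c])\Big)\xi(dz),$$ for $x^*,y^*\in E^*$.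
   Context: $E^*$ is the continuous dual of $E$ and $\langle\cdot,\cdot\rangle:E\times E^*\to\mathbb{C}$ the dual product. In the characteristic functional: $R:E^*\to E$ is a conjugate symmetric, positive semidefinite covariance operator (of the type $\langle Rx^*,y^*\rangle=\int_E\overline{\langle z,x^*\rangle}\langle z,y^*\rangle\,\gamma(dz)$ for a Gaussian measure $\gamma$, so $\langle Rx^*,y^*\rangle$ is conjugate-linear in $x^*$ and linear in $y^*$); $\{\rho(z,\cdot)\}_{z\in E}$ is a family of Lévy measures on $\mathbb{R}$; $\xi$ is a $\sigma$-finite measure on $E$, called a control measure; $\kappa(u):=\mathbf{1}_{\{|u|<1\}}+\frac1{|u|}\mathbf{1}_{\{|u|\ge1\}}$, $u\in\mathbb{R}$. A Lévy measure on $\mathbb{R}$ is a measure $\nu$ with $\nu(\{0\})=0$ and $\int\min(1,u^2)\nu(du)<\infty$. Codifferences. For $x^*,y^*\in E^*$, $$C^{=}_\mu(x^*,y^* ):=\log\int_E e^{i\mathrm{Re}\langle z,x^*-y^*\rangle}\mu(dz)-\log\int_E e^{i\mathrm{Re}\langle z,x^*\rangle}\mu(dz)-\log\int_E e^{-i\mathrm{Re}\langle z,y^*\rangle}\mu(dz),$$ $$C^{\neq}_\mu(x^*,y^* ):=\log\int_E e^{i\mathrm{Re}\langle z,x^*\rangle-i\mathrm{Im}\langle z,y^*\rangle}\mu(dz)-\log\int_E e^{i\mathrm{Re}\langle z,x^*\rangle}\mu(dz)-\log\int_E e^{-i\mathrm{Im}\langle z,y^*\rangle}\mu(dz),$$ where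 $\log$ of the characteristic functional is the exponent displayed in the claim; note $-\mathrm{Im}\langle z,y^*\rangle=\mathrm{Re}\langle z,iy^*\rangle$. *)

(* Defs.v *)
From HB Require Import structures.
From mathcomp Require Import all_boot all_order all_algebra.
From mathcomp Require Import all_classical all_reals all_analysis.
From mathcomp Require Import complex.

Set Implicit Arguments.
Unset Strict Implicit.
Unset Printing Implicit Defensive.
Import Order.TTheory GRing.Theory Num.Theory.
Import numFieldNormedType.Exports.
Local Open Scope classical_set_scope.
Local Open Scope ring_scope.

Section Complex.
Context {R : realType}.

Definition expc (w : R[i]) : R[i] :=
  Complex (expR (complex.Re w) * cos (complex.Im w))
          (expR (complex.Re w) * sin (complex.Im w)).

Definition expi (t : R) : R[i] := expc (Complex 0 t).

Definition cintegrable d (T : measurableType d)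
    (m : {measure set T -> \bar R}) (f : T -> R[i]) : Prop :=
  m.-integrable setT (fun x => (complex.Re (f x))%:E) /\
  m.-integrable setT (fun x => (complex.Im (f x))%:E).

(* Meaningful when [cintegrable m f]; both parts are total operators. *)
Definition cintegral d (T : measurableType d)
    (m : {measure set T -> \bar R}) (f : T -> R[i]) : R[i] :=
  Complex (\int[m]_(x in setT) complex.Re (f x))
          (\int[m]_(x in setT) complex.Im (f x)).

Definition is_levy_measure
    (nu : {measure set (measurableTypeR R) -> \bar R}) : Prop :=
  nu [set 0] = 0%E /\
  (\int[nu]_(u in setT) (Num.min 1 (u ^+ 2))%:E < +oo)%E.

Definition kappa (u : R) : R := if `|u| < 1 then 1 else `|u|^-1.

End Complex.

Section Dual.
Context {R : realType} {E : completeNormedModType R[i]}.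

Definition dual_pred : {pred (E -> R[i]^o)} :=
  [pred f : E -> R[i]^o | `[< linear f /\ continuous f >]].

Lemma dual_submod_closed : submod_closed dual_pred.
Proof.
split.
  apply/asboolP; split; last by move=> x; exact: cvg_cst.
  by move=> a u v; rewrite [LHS]/= [RHS]/= scaler0 addr0.
move=> a f g /asboolP[lf cf] /asboolP[lg cg]; apply/asboolP; split.
  move=> b u v.
  change (a *: f (b *: u + v) + g (b *: u + v)
          = b *: (a *: f u + g u) + (a *: f v + g v)).
  rewrite lf lg !scalerDr !scalerA (mulrC a b) -!addrA.
  by congr (_ + _); rewrite addrCA.
by move=> x; apply: cvgD; [apply: cvgZr; exact: cf | exact: cg].
Qed.

HB.instance Definition _ :=
  GRing.isSubmodClosed.Build R[i] (E -> R[i]^o) dual_pred dual_submod_closed.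

Record dual := Dual { dual_fun : E -> R[i]^o; _ : dual_fun \in dual_pred }.

HB.instance Definition _ := [isSub for dual_fun].
HB.instance Definition _ := [Choice of dual by <:].
HB.instance Definition _ := [SubChoice_isSubLmodule of dual by <:].

Definition pairing (z : E) (x : dual) : R[i] := dual_fun x z.

End Dual.
Arguments dual {R} E.

Notation borel_type E := (g_sigma_algebraType (@open E)).

Definition separable (T : topologicalType) : Prop :=
  exists D : set T, countable D /\ dense D.

Section Measures.
Context {R : realType} {E : completeNormedModType R[i]}.

(* ((m1 * m2) A = \int m2 (A - z) m1(dz)); stated on set functions so that it
   can be iterated. *)
Definition convolution (m1 : {measure set (borel_type E) -> \bar R})
    (m2 : set E -> \bar R) (A : set E) : \bar R :=
  (\int[m1]_(z in setT) m2 [set w : E | A ((z : E) + w)%R])%E.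

Fixpoint convolution_power (m : {measure set (borel_type E) -> \bar R})
    (n : nat) : set E -> \bar R :=
  if n is k.+1 then convolution m (convolution_power m k) else (\d_(0%R : borel_type E)).

Definition infinitely_divisible (mu : probability (borel_type E) R) : Prop :=
  forall n : nat, (0 < n)%N -> exists nu : probability (borel_type E) R,
    forall A : set (borel_type E), measurable A ->
      mu A = convolution_power nu n A.

(* The law of Re <., x> is a possibly degenerate centered normal law for
   every x; the real parts of the elements of the dual are exactly the
   continuous real-linear functionals. [normal_prob 0 0] is not a Dirac mass,
   hence the separate degenerate case. *)
Definition centered_gaussian (g : probability (borel_type E) R) : Prop :=
  forall x : dual E,
    (exists2 s : R, s != 0 & forall A : set (measurableTypeR R), measurable A ->
       g [set z | A (complex.Re (pairing z x))] = normal_prob 0 s A) \/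
    (forall A : set (measurableTypeR R), measurable A ->
       g [set z | A (complex.Re (pairing z x))] = \d_(0 : measurableTypeR R) A).

Definition covariance_operator (Q : dual E -> E) : Prop :=
  [/\ forall x y : dual E, pairing (Q x) y = conjc (pairing (Q y) x),
      forall x : dual E, 0 <= pairing (Q x) x
    & exists2 g : probability (borel_type E) R, centered_gaussian g &
        forall x y : dual E,
          pairing (Q x) y =
          cintegral g (fun z => conjc (pairing z x) * pairing z y)].

Definition char_functional (mu : probability (borel_type E) R)
    (x : dual E) : R[i] :=
  cintegral mu (fun z => expi (complex.Re (pairing z x))).

(* For a Levy measure this integral converges absolutely for every a. *)
Definition levy_exponent (nu : {measure set (measurableTypeR R) -> \bar R})
    (a : R) : R[i] :=
  cintegral nu
    (fun u : R => expi (u * a) - 1 - Complex 0 (u * kappa u * a)).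

Definition levy_exponent_integrable
    (xi : {measure set (borel_type E) -> \bar R})
    (rho : R.-ker (borel_type E) ~> (measurableTypeR R)) : Prop :=
  forall x : dual E,
    cintegrable xi (fun z => levy_exponent (rho z) (complex.Re (pairing z x))).

Definition char_exponent (Q : dual E -> E)
    (xi : {measure set (borel_type E) -> \bar R})
    (rho : R.-ker (borel_type E) ~> (measurableTypeR R))
    (x : dual E) : R[i] :=
  - (4^-1 * pairing (Q x) x)
  + cintegral xi (fun z => levy_exponent (rho z) (complex.Re (pairing z x))).

(* In the codifferences the logarithm of the characteristic functional is a
   designated function logcf with expc (logcf x) = char_functional mu x: the
   complex logarithm is not single-valued. *)
Definition log_char_functional (mu : probability (borel_type E) R)
    (logcf : dual E -> R[i]) : Prop :=
  forall x : dual E, char_functional mu x = expc (logcf x).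

Definition codifference_eq (logcf : dual E -> R[i]) (x y : dual E) : R[i] :=
  logcf (x - y) - logcf x - logcf (- y).

(* Re <z, x> - Im <z, y> = Re <z, x + i y> and - Im <z, y> = Re <z, i y>. *)
Definition codifference_ne (logcf : dual E -> R[i]) (x y : dual E) : R[i] :=
  logcf (x + Complex 0 1 *: y) - logcf x - logcf (Complex 0 1 *: y).

(* [powR] satisfies 0 `^ 0 = 1. *)
Definition codifference_integral
    (xi : {measure set (borel_type E) -> \bar R})
    (rho : R.-ker (borel_type E) ~> (measurableTypeR R))
    (p c : R) (a b : E -> R) : \bar R :=
  (\int[xi]_(z in setT)
     ((2 `^ (- p))%:E *
        (\int[rho z]_(u in `[(- c)%R, c]%classic)
           (`|u| `^ p * `|a z * b z| `^ (p / 2))%:E)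
      + rho z (~` `[(- c)%R, c]%classic)))%E.

End Measures.

(* Main.v *)
Require Import Defs.
From HB Require Import structures.
From mathcomp Require Import all_boot all_order all_algebra.
From mathcomp Require Import all_classical all_reals all_analysis.
From mathcomp Require Import complex.
From mathcomp Require Import measurable_realfun ring lra.

Set Implicit Arguments.
Unset Strict Implicit.
Unset Printing Implicit Defensive.
Import Order.TTheory GRing.Theory Num.Theory.
Import numFieldNormedType.Exports.
Local Open Scope classical_set_scope.
Local Open Scope ring_scope.

(** Write psi for the exponent of the characteristic functional.  Both
    codifferences are second differences psi (x + y) - psi x - psi y, with
    -y or i y in the place of y, so one bound for second differences suffices.

    In a second difference the Gaussian part polarizes to - Re <Qx, y> / 2.
    In the jump part, with a = Re <z, x> and b = Re <z, y>, the compensators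
    u kappa(u) a are linear in a and cancel, which leaves the integrand
      (e^{iua} - 1) (e^{iub} - 1)
        = - 4 sin (ua/2) sin (ub/2) e^{iu(a+b)/2}.
    Each sine is at most 1 in absolute value, so the integrand is at most 4:
    this is used for |u| > c.  Moreover |sin t| <= |t|^q for 0 <= q <= 1, and
    q = p/2 gives 4 * 2^{-p} |u|^p |ab|^{p/2}: this is used for |u| <= c.

    These bounds are applied to the real and to the imaginary part separately,
    first under the inner and then under the outer integral.  The real and the
    imaginary part of the jump part are each at most 4 times the integral on
    the right-hand side, so its modulus is at most 8 <= 16 times that integral.

    Splitting the jump part of psi requires the compensated integrand
    e^{iua} - 1 - iu kappa(u) a to be integrable for a Levy measure, which
    holds because it is O(min(1, u^2)) for fixed a. *)

(** * Integrals *)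

(** The larger function may fail to be measurable, since the integral of a
    nonnegative function is a supremum over the simple functions below it.
    This is used with a majorant that is itself an integral against a kernel,
    whose measurability would need a separate argument. *)
Lemma ge0_le_integral_majorant d (T : measurableType d) (R : realType)
    (m : {measure set T -> \bar R}) (f g : T -> \bar R) :
  (forall t, 0 <= f t)%E -> (forall t, f t <= g t)%E ->
  (\int[m]_(t in setT) f t <= \int[m]_(t in setT) g t)%E.
Proof.
move=> f0 fg.
have g0 t : (0 <= g t)%E by exact: le_trans (fg t).
rewrite !ge0_integralTE//; apply: ereal_sup_le => _ [h hf <-].
by exists h => // t; exact: le_trans (fg t).
Qed.

(** Dividing by k on the side of the measurable function f, rather than pulling
    k out of the integral of g, keeps g arbitrary. *)
Lemma normr_Rintegral_le d (T : measurableType d) (R : realType)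
    (m : {measure set T -> \bar R}) (f : T -> R) (g : T -> \bar R) (k : R) :
  0 < k -> m.-integrable setT (EFin \o f) ->
  (forall t, (`|f t|)%:E <= k%:E * g t)%E ->
  ((`|\int[m]_(t in setT) f t|)%:E <= k%:E * \int[m]_(t in setT) g t)%E.
Proof.
move=> k0 intf fg; have [mf _] := integrableP _ _ _ intf.
have mf' : measurable_fun setT f by exact/measurable_EFinP.
rewrite -abse_EFin /Rintegral fineK; last exact: integrable_fin_num.
apply: le_trans (le_abse_integral _ measurableT mf) _.
under eq_integral => t _ do
  rewrite /= -[X in X%:E](@mulVKf _ k) ?gt_eqF// EFinM.
rewrite ge0_integralZl//=; last by rewrite lee_fin ltW.
- apply: lee_wpmul2l; first by rewrite lee_fin ltW.
  apply: ge0_le_integral_majorant => t.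
    by rewrite lee_fin mulr_ge0// invr_ge0 ltW.
  by rewrite EFinM lee_pdivrMl.
- apply/measurable_EFinP; apply: measurable_funM => //.
  exact: measurableT_comp.
- by move=> t _; rewrite lee_fin mulr_ge0// invr_ge0 ltW.
Qed.

Lemma RintegralBB d (T : measurableType d) (R : realType)
    (m : {measure set T -> \bar R}) (f g h : T -> R) :
  m.-integrable setT (EFin \o f) -> m.-integrable setT (EFin \o g) ->
  m.-integrable setT (EFin \o h) ->
  m.-integrable setT (EFin \o (fun t => f t - g t - h t)) /\
  \int[m]_(t in setT) f t - \int[m]_(t in setT) g t - \int[m]_(t in setT) h t
  = \int[m]_(t in setT) (f t - g t - h t).
Proof.
move=> intf intg inth.
have intfg : m.-integrable setT (EFin \o (fun t => f t - g t)).
  exact: (integrableB measurableT intf intg).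
split; first exact: (integrableB measurableT intfg inth).
by rewrite -!RintegralB.
Qed.

Lemma ge0_integral_if_cst d (T : measurableType d) (R : realType)
    (m : {measure set T -> \bar R}) (A : set T) (f : T -> \bar R) :
  measurable A -> measurable_fun A f -> (forall t, 0 <= f t)%E ->
  (\int[m]_(t in setT) (if t \in A then f t else 1)
   = \int[m]_(t in A) f t + m (~` A))%E.
Proof.
move=> mA mf f0; have mAc : measurable (~` A) by exact: measurableC.
rewrite -[setT](setUv A) integral_setU//; last 2 first.
- rewrite setUv; apply: measurable_fun_if => //.
  + apply: (measurable_fun_bool true).
    by rewrite setTI preimage_true set_mem_set.
  + by rewrite setTI preimage_true set_mem_set.
- by apply/disj_setPS; rewrite setICr.
congr (_ + _)%E; first by apply: eq_integral => t ->.
rewrite -[RHS]mul1e -integral_cst//; apply: eq_integral => t.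
by rewrite in_setC => /negbTE ->.
Qed.

(** * Trigonometric estimates *)

Section trig.
Context {R : realType}.
Implicit Types s t a b q : R.

Lemma normr_sin_le_id t : `|sin t| <= `|t|.
Proof.
wlog t0 : t / 0 <= t => [hw|].
  case: (leP 0 t) => [/hw//|/ltW t0].
  by rewrite -normrN -sinN -(normrN t); apply: hw; rewrite oppr_ge0.
have [|s _] := @MVT_segment R sin cos 0 t t0.
- by apply: continuous_subspaceT => x; exact: continuous_sin.
rewrite sin0 !subr0 => ->.
by rewrite normrM ler_piMl// cos_max.
Qed.

Lemma cos_half_angle t : cos t = 1 - 2 * sin (t / 2) ^+ 2.
Proof.
have {1}-> : t = t / 2 *+ 2 by field.
by rewrite cos_mulr2n cos2sin2; ring.
Qed.

Lemma normr_cosB1 t : `|cos t - 1| = 2 * `|sin (t / 2)| ^+ 2.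
Proof.
rewrite cos_half_angle addrAC subrr sub0r normrN normrM normrX.
by rewrite (@ger0_norm _ 2).
Qed.

Lemma normr_cosB1_le t : `|cos t - 1| <= `|t|.
Proof.
rewrite normr_cosB1.
have h := normr_sin_le_id (t / 2); have h1 := sin_max (t / 2).
have -> : `|t| = 2 * `|t / 2| by rewrite normrM (@ger0_norm _ 2^-1)//; lra.
by rewrite ler_pM2l// (le_trans _ h)// expr2 ler_piMl.
Qed.

Lemma normr_cosB1_le_sqr t : `|cos t - 1| <= t ^+ 2.
Proof.
rewrite normr_cosB1.
have h := normr_sin_le_id (t / 2).
have -> : t ^+ 2 = 4 * `|t / 2| ^+ 2 by rewrite real_normK ?num_real//; field.
rewrite (@le_trans _ _ (2 * `|t / 2| ^+ 2))//.
  by rewrite ler_pM2l// lerXn2r ?nnegrE.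
by rewrite ler_wpM2r ?sqr_ge0// ler_nat.
Qed.

(** The mean value theorem for sin t - t, whose derivative at s is bounded by
    |s|; the quadratic (not cubic) order is all that Levy measures require. *)
Lemma normr_sinB_le_sqr t : `|sin t - t| <= t ^+ 2.
Proof.
wlog t0 : t / 0 <= t => [hw|].
  case: (leP 0 t) => [/hw//|/ltW t0].
  have : `|sin (- t) - - t| <= (- t) ^+ 2 by apply: hw; rewrite oppr_ge0.
  by rewrite sinN sqrrN -opprD normrN.
have [|s] := @MVT_segment R (sin - id) (cos - cst 1) 0 t t0.
  apply: continuous_subspaceT => x.
  by apply: cvgB; [exact: continuous_sin|exact: cvg_id].
rewrite in_itv /= => /andP[s0 st].
have -> : (sin - id) t - (sin - id) 0 = sin t - t.
  by rewrite !fctE/= sin0 !subr0.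
rewrite !fctE subr0 => ->.
rewrite normrM (ger0_norm t0) expr2 ler_wpM2r//.
by rewrite (le_trans (normr_cosB1_le s))// ger0_norm.
Qed.

Lemma sin_half_angle t : sin t = 2 * sin (t / 2) * cos (t / 2).
Proof.
have {1}-> : t = t / 2 *+ 2 by field.
by rewrite sin_mulr2n; ring.
Qed.

(** This and the next identity are the real and imaginary parts of
    (e^{is} - 1) (e^{it} - 1) = - 4 sin (s/2) sin (t/2) e^{i(s+t)/2}. *)
Lemma cos_second_difference s t :
  cos (s + t) - cos s - cos t + 1
  = - 4 * (sin (s / 2) * sin (t / 2)) * cos ((s + t) / 2).
Proof.
rewrite mulrDl !cosD (cos_half_angle s) (cos_half_angle t).
by rewrite (sin_half_angle s) (sin_half_angle t); ring.
Qed.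

Lemma sin_second_difference s t :
  sin (s + t) - sin s - sin t
  = - 4 * (sin (s / 2) * sin (t / 2)) * sin ((s + t) / 2).
Proof.
rewrite mulrDl !sinD (cos_half_angle s) (cos_half_angle t).
by rewrite (sin_half_angle s) (sin_half_angle t); ring.
Qed.

(** Interpolation between |sin t| <= 1 and |sin t| <= |t|: a number in [0, 1] is
    at most its q-th power. *)
Lemma normr_sin_le_powR q t : 0 <= q <= 1 -> `|sin t| <= `|t| `^ q.
Proof.
move=> /andP[q0 q1]; have [->|s0] := eqVneq (sin t) 0.
  by rewrite normr0 powR_ge0.
apply: (@le_trans _ _ (`|sin t| `^ q)); last first.
  by apply: ge0_ler_powR; rewrite ?nnegrE// normr_sin_le_id.
rewrite -[leLHS]powRr1//; apply: ger_powR => //.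
by rewrite normr_gt0 s0 sin_max.
Qed.

End trig.

(** The factor 2 ^ (-p) collects the two halved angles, each to the power
    p / 2. *)
Lemma normr_sinM_le_powR (R : realType) (p a b u : R) : 0 <= p -> p <= 2 ->
  `|sin (u * a / 2) * sin (u * b / 2)| <=
  2 `^ (- p) * (`|u| `^ p * `|a * b| `^ (p / 2)).
Proof.
move=> p0 p2.
have q01 : 0 <= p / 2 <= 1 by rewrite divr_ge0//= ler_pdivrMr// mul1r.
rewrite normrM (le_trans (ler_pM _ _ (normr_sin_le_powR _ q01)
  (normr_sin_le_powR _ q01)))//.
rewrite -powRM// -normrM.
have -> : u * a / 2 * (u * b / 2) = (2^-1 * u) ^+ 2 * (a * b) by ring.
rewrite normrM powRM// normrX -powR_mulrn// -powRrM mulrA.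
have -> : 2%:R * p / 2 = p by field.
rewrite normrM powRM// (@ger0_norm _ 2^-1)// mulrA.
by rewrite -(@powR_inv1 _ 2)// -powRrM mulN1r.
Qed.

(** * Levy measures *)

Section levy.
Context {R : realType}.
Variable nu : {measure set (measurableTypeR R) -> \bar R}.
Hypothesis nu_levy : is_levy_measure nu.

Lemma levy_integrable (k : R) (f : R -> R) :
  measurable_fun setT f -> 0 <= k ->
  (forall u, `|f u| <= k * Num.min 1 (u ^+ 2)) ->
  nu.-integrable setT (EFin \o f).
Proof.
move=> mf k0 fk; have [_ nufin] := nu_levy.
have m_min : measurable_fun setT (fun u : R => Num.min 1 (u ^+ 2)).
  by apply: measurable_funTS; apply: measurable_minr => //.
have min_ge0 u : 0 <= Num.min 1 (u ^+ 2 : R) by rewrite le_min ler01 sqr_ge0.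
apply: (@le_integrable _ (measurableTypeR R) R nu setT measurableT (EFin \o f)
  (fun u => (k%:E * (Num.min 1 (u ^+ 2))%:E)%E)).
- exact/measurable_EFinP.
- move=> u _ /=; rewrite lee_fin (le_trans (fk u))//.
  by rewrite ler_norm.
apply: integrableZl => //; apply/integrableP; split.
  exact/measurable_EFinP.
by under eq_integral => u _ do rewrite /= ger0_norm//.
Qed.

Lemma measurable_kappa : measurable_fun setT (@kappa R).
Proof.
apply: measurable_fun_ifT => //.
  by apply: measurable_fun_ltr.
have -> : (fun u : R => `|u|^-1) = (@powR R ^~ (-1)) \o Num.norm.
  by apply/funext => u; rewrite /= powR_inv1.
exact: measurableT_comp.
Qed.

(** Near 0 the cosine is quadratically close to 1; elsewhere |cos - 1| <= 2. *)
Lemma levy_integrand_Re_integrable a :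
  nu.-integrable setT (fun u : R => (cos (u * a) - 1)%:E).
Proof.
apply: (@levy_integrable (2 + a ^+ 2)).
- apply: measurable_funB => //.
  apply: measurableT_comp; last exact: measurable_funM.
  by apply: continuous_measurable_fun; exact: continuous_cos.
- by rewrite addr_ge0 ?sqr_ge0.
move=> u; case: (leP 1 (u ^+ 2)) => h.
  rewrite mulr1 (le_trans (ler_normB _ _))// normr1 [leRHS]addrC.
  by have := cos_max (u * a); have := sqr_ge0 a; lra.
rewrite (le_trans (normr_cosB1_le_sqr _))// exprMn mulrC.
by rewrite ler_wpM2r ?sqr_ge0// lerDr.
Qed.

(** For |u| < 1 the compensator u kappa(u) a is the linear term u a of the sine,
    with a quadratic remainder; for |u| >= 1 it has absolute value |a|. *)
Lemma levy_integrand_Im_integrable a :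
  nu.-integrable setT (fun u : R => (sin (u * a) - u * kappa u * a)%:E).
Proof.
apply: (@levy_integrable (1 + `|a| + a ^+ 2)).
- apply: measurable_funB => //.
    apply: measurableT_comp; last exact: measurable_funM.
    by apply: continuous_measurable_fun; exact: continuous_sin.
  do 2 apply: measurable_funM => //.
  exact: measurable_kappa.
- by rewrite !addr_ge0 ?sqr_ge0.
move=> u; rewrite /kappa; case: (ltP `|u| 1) => h.
  have u1 : u ^+ 2 <= 1.
    by rewrite -real_normK ?num_real// expr_le1// ltW.
  rewrite mulr1 (min_idPr u1) (le_trans (normr_sinB_le_sqr _))// exprMn mulrC.
  by rewrite ler_wpM2r ?sqr_ge0// lerDr addr_ge0.
have u1 : 1 <= u ^+ 2.
  by rewrite -real_normK ?num_real// expr_ge1.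
rewrite (min_idPl u1) mulr1 (le_trans (ler_normB _ _))//.
have -> : `|u * `|u|^-1 * a| = `|a|.
  rewrite !normrM normfV normr_id divff ?mul1r//.
  by rewrite gt_eqF// (lt_le_trans _ h).
by have := sin_max (u * a); have := sqr_ge0 a; lra.
Qed.

Lemma levy_exponentE a : levy_exponent nu a =
  Complex (\int[nu]_(u in setT) (cos (u * a) - 1))
          (\int[nu]_(u in setT) (sin (u * a) - u * kappa u * a)).
Proof.
rewrite /levy_exponent /cintegral; congr Complex; apply: eq_Rintegral => u _ /=.
  by rewrite expR0 mul1r subr0.
by rewrite expR0 mul1r subr0.
Qed.

(** The compensators are linear in a, so they cancel in second differences of
    the exponent; integrability licenses merging the three integrals. *)
Lemma Re_levy_second_difference a b :
  nu.-integrable setT (EFin \o (fun u : R =>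
    cos (u * a + u * b) - cos (u * a) - cos (u * b) + 1)) /\
  complex.Re (levy_exponent nu (a + b) - levy_exponent nu a
              - levy_exponent nu b)
  = \int[nu]_(u in setT) (cos (u * a + u * b) - cos (u * a) - cos (u * b) + 1).
Proof.
have int := levy_integrand_Re_integrable.
rewrite !levy_exponentE /=.
have [] := RintegralBB (int (a + b)) (int a) (int b).
have -> : (fun u : R => cos (u * (a + b)) - 1 - (cos (u * a) - 1) -
    (cos (u * b) - 1))
  = (fun u : R => cos (u * a + u * b) - cos (u * a) - cos (u * b) + 1).
  by apply/funext => u; rewrite mulrDr; ring.
by [].
Qed.

Lemma Im_levy_second_difference a b :
  nu.-integrable setT (EFin \o (fun u : R =>
    sin (u * a + u * b) - sin (u * a) - sin (u * b))) /\
  complex.Im (levy_exponent nu (a + b) - levy_exponent nu a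
              - levy_exponent nu b)
  = \int[nu]_(u in setT) (sin (u * a + u * b) - sin (u * a) - sin (u * b)).
Proof.
have int := levy_integrand_Im_integrable.
rewrite !levy_exponentE /=.
have [] := RintegralBB (int (a + b)) (int a) (int b).
have -> : (fun u : R => sin (u * (a + b)) - u * kappa u * (a + b) -
    (sin (u * a) - u * kappa u * a) - (sin (u * b) - u * kappa u * b))
  = (fun u : R => sin (u * a + u * b) - sin (u * a) - sin (u * b)).
  by apply/funext => u; rewrite mulrDr; ring.
by [].
Qed.

End levy.

(** On [-c, c] the product of sines is bounded by powers, outside by 1. *)
Lemma levy_integral_le (R : realType)
    (nu : {measure set (measurableTypeR R) -> \bar R})
    (p c a b : R) (F : R -> R) : 0 <= p -> p <= 2 ->
  nu.-integrable setT (EFin \o F) ->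
  (forall u, `|F u| <= 4 * `|sin (u * a / 2) * sin (u * b / 2)|) ->
  ((`|\int[nu]_(u in setT) F u|)%:E <=
   4%:E * ((2 `^ (- p))%:E *
      (\int[nu]_(u in `[(- c)%R, c]%classic)
         (`|u| `^ p * `|a * b| `^ (p / 2))%:E)
     + nu (~` `[(- c)%R, c]%classic)))%E.
Proof.
move=> p0 p2 intF Fle.
set A := `[(- c)%R, c]%classic.
pose f (u : R) := `|u| `^ p * `|a * b| `^ (p / 2).
have f0 u : 0 <= f u by rewrite mulr_ge0 ?powR_ge0.
have mf : measurable_fun A f.
  apply: measurable_funTS; apply: measurable_funM => //.
  exact: (@measurableT_comp _ _ _ _ _ _ (@powR R ^~ p)).
have k0 : 0 <= 2 `^ (- p) :> R by exact: powR_ge0.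
have mA : measurable A by exact: measurable_itv.
rewrite -ge0_integralZl//; last exact/measurable_EFinP.
rewrite -ge0_integral_if_cst//; last first.
  by apply: measurable_funeM; exact/measurable_EFinP.
apply: normr_Rintegral_le => // u.
case: ifPn => _; rewrite lee_fin (le_trans (Fle u))// ler_pM2l//.
  exact: normr_sinM_le_powR.
by rewrite normrM mulr_ile1// sin_max.
Qed.

(** * The modulus of a complex number *)

Lemma normc_le_normrD (R : realType) (w : R[i]) :
  Normc.normc w <= `|complex.Re w| + `|complex.Im w|.
Proof.
case: w => a b /=.
rewrite -(@ger0_norm _ (`|a| + `|b|)) ?addr_ge0// -sqrtr_sqr ler_wsqrtr//.
by rewrite sqrrD !real_normK ?num_real// lerD2r lerDl mulrn_wge0 ?mulr_ge0.
Qed.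

Lemma normc_realD_le (R : realType) (r : R) (w : R[i]) :
  Normc.normc (real_complex R r + w)
  <= `|r| + (`|complex.Re w| + `|complex.Im w|).
Proof.
case: w => a b; apply: (le_trans (normc_le_normrD _)).
by rewrite /= add0r addrA lerD2r ler_normD.
Qed.

(** * The Gaussian part *)

Section dual_pairing.
Context {R : realType} {E : completeNormedModType R[i]}.

Lemma pairingD (z : E) (x y : dual E) :
  pairing z (x + y) = pairing z x + pairing z y.
Proof. by []. Qed.

Lemma pairingN (z : E) (x : dual E) : pairing z (- x) = - pairing z x.
Proof. by []. Qed.

Lemma pairingZ (z : E) (k : R[i]) (x : dual E) :
  pairing z (k *: x) = k * pairing z x.
Proof. by []. Qed.

(** [pairing] is linear in its second argument by definition, and conjugate
    symmetry turns this into additivity of <Qx, y> in x; the two cross terms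
    are conjugate to each other. *)
Lemma covariance_polarization (Q : dual E -> E) (x y : dual E) :
  (forall u v : dual E, pairing (Q u) v = conjc (pairing (Q v) u)) ->
  pairing (Q (x + y)) (x + y) - pairing (Q x) x - pairing (Q y) y
  = 2 * real_complex R (complex.Re (pairing (Q x) y)).
Proof.
move=> Qsym; rewrite -addcJ -Qsym pairingD !(Qsym (x + y)) !pairingD !rmorphD/=.
by rewrite -!Qsym; ring.
Qed.

End dual_pairing.

(** * Second differences of the characteristic exponent *)

(** The rearrangement of the exponents, with s = <Qx, x>, t = <Qy, y>,
    r = Re <Qx, y> and u, v, w the jump parts. *)
Lemma quadratic_part_identity (K : numFieldType) (r s t u v w : K) :
  - (4^-1 * (2 * r + t + s)) + u - (- (4^-1 * s) + v) - (- (4^-1 * t) + w)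
  = - (2^-1 * r) + (u - v - w).
Proof.
have -> : 2^-1 = 4^-1 * 2 :> K by field.
by move: 4^-1 => h; ring.
Qed.

(** The Gaussian term r plus the two bounds on the real and the imaginary part
    of the jump term, which add up to 8 I. *)
Lemma EFin_add_le_16mul (R : realType) (r s t : R) (I : \bar R) :
  (0 <= I)%E -> (s%:E <= 4%:E * I)%E -> (t%:E <= 4%:E * I)%E ->
  ((r + (s + t))%:E <= r%:E + 16%:E * I)%E.
Proof.
case: I => [i|_ _ _|//]; last by rewrite gt0_muley// addey// leey.
by rewrite -!EFinM -EFinD !lee_fin; lra.
Qed.

Section codifference.
Context {R : realType} {E : completeNormedModType R[i]}.
Variable Q : dual E -> E.
Variable rho : R.-ker (borel_type E) ~> (measurableTypeR R).
Variable xi : {measure set (borel_type E) -> \bar R}.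
Hypothesis Qsym :
  forall u v : dual E, pairing (Q u) v = conjc (pairing (Q v) u).
Hypothesis rho_levy : forall z : E, is_levy_measure (rho z).
Hypothesis xi_int : levy_exponent_integrable xi rho.
Variables p c : R.
Hypotheses (p_ge0 : 0 <= p) (p_le2 : p <= 2).

(** The bound on the jump part for a fixed z; a and b stand for Re <z, x> and
    Re <z, y>. *)
Lemma levy_second_difference_le (z : E) (a b : R)
    (w := levy_exponent (rho z) (a + b) - levy_exponent (rho z) a
          - levy_exponent (rho z) b)
    (B := ((2 `^ (- p))%:E *
      (\int[rho z]_(u in `[(- c)%R, c]%classic)
         (`|u| `^ p * `|a * b| `^ (p / 2))%:E)
     + rho z (~` `[(- c)%R, c]%classic))%E) :
  ((`|complex.Re w|)%:E <= 4%:E * B)%E /\ ((`|complex.Im w|)%:E <= 4%:E * B)%E.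
Proof.
have [intRe ReE] := Re_levy_second_difference (rho_levy z) a b.
have [intIm ImE] := Im_levy_second_difference (rho_levy z) a b.
split.
  rewrite {}/w {}/B ReE; apply: levy_integral_le => // u.
  rewrite cos_second_difference 2!normrM normrN (@ger0_norm _ 4)//.
  by rewrite ler_piMr// cos_max.
rewrite {}/w {}/B ImE; apply: levy_integral_le => // u.
rewrite sin_second_difference 2!normrM normrN (@ger0_norm _ 4)//.
by rewrite ler_piMr// sin_max.
Qed.

Lemma char_exponent_second_difference_le (x y : dual E)
    (psi := char_exponent Q xi rho) :
  ((Normc.normc (psi (x + y) - psi x - psi y))%:E
     <= (2^-1 * `|complex.Re (pairing (Q x) y)|)%:E
        + 16%:E * codifference_integral xi rho p c
            (fun z => complex.Re (pairing z x))
            (fun z => complex.Re (pairing z y)))%E.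
Proof.
pose L (v : dual E) (z : E) := levy_exponent (rho z) (complex.Re (pairing z v)).
(* The real part of a sum splits only once its summands are constructors. *)
have LD z : L (x + y) z = levy_exponent (rho z)
    (complex.Re (pairing z x) + complex.Re (pairing z y)).
  by rewrite /L pairingD; case: (pairing z x) (pairing z y) => ? ? [].
pose D := cintegral xi (L (x + y)) - cintegral xi (L x) - cintegral xi (L y).
set q := complex.Re (pairing (Q x) y).
have psiE : psi (x + y) - psi x - psi y = real_complex R (- (2^-1 * q)) + D.
  have /eqP := covariance_polarization x y Qsym.
  rewrite -/q !subr_eq => /eqP Qxy.
  rewrite /psi /char_exponent Qxy /D rmorphN rmorphM fmorphV rmorph_nat.
  exact: quadratic_part_identity.
set I := codifference_integral _ _ _ _ _ _.
have I0 : (0 <= I)%E.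
  apply: integral_ge0 => z _; rewrite adde_ge0// mule_ge0 ?lee_fin ?powR_ge0//.
  by apply: integral_ge0 => u _; rewrite lee_fin mulr_ge0 ?powR_ge0.
have [intxyR intxyI] := xi_int (x + y).
have [intxR intxI] := xi_int x; have [intyR intyI] := xi_int y.
have ReD : ((`|complex.Re D|)%:E <= 4%:E * I)%E.
  have [intR eR] := RintegralBB intxyR intxR intyR.
  have -> : complex.Re D =
      \int[xi]_(z in setT) complex.Re (L (x + y) z - L x z - L y z).
    exact: eR.
  apply: normr_Rintegral_le => // z.
  by rewrite LD; exact: (levy_second_difference_le z _ _).1.
have ImD : ((`|complex.Im D|)%:E <= 4%:E * I)%E.
  have [intI eI] := RintegralBB intxyI intxI intyI.
  have -> : complex.Im D =
      \int[xi]_(z in setT) complex.Im (L (x + y) z - L x z - L y z).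
    exact: eI.
  apply: normr_Rintegral_le => // z.
  by rewrite LD; exact: (levy_second_difference_le z _ _).2.
rewrite psiE.
apply: le_trans (EFin_add_le_16mul _ I0 ReD ImD).
rewrite lee_fin (le_trans (normc_realD_le _ _))// normrN normrM.
by rewrite (@ger0_norm _ 2^-1).
Qed.

Lemma eq_codifference_integral (a b b' : E -> R) :
  (forall z, b' z = - b z) ->
  codifference_integral xi rho p c a b' = codifference_integral xi rho p c a b.
Proof.
by move=> bE; apply: eq_integral => z _; rewrite bE mulrN normrN.
Qed.

End codifference.

Theorem lemma3p2 (R : realType) (E : completeNormedModType R[i])
  (sepE : separable E)
  (mu : probability (borel_type E) R)
  (mu_id : infinitely_divisible mu)
  (Q : dual E -> E)
  (Q_cov : covariance_operator Q)
  (rho : R.-ker (borel_type E) ~> (measurableTypeR R))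
  (rho_levy : forall z : E, is_levy_measure (rho z))
  (xi : {sigma_finite_measure set (borel_type E) -> \bar R})
  (xi_int : levy_exponent_integrable xi rho)
  (mu_cf : log_char_functional mu (char_exponent Q xi rho))
  (p c : R) (p_ge0 : 0 <= p) (p_le2 : p <= 2) (c_gt0 : 0 < c)
  (x y : dual E) :
  ((Normc.normc (codifference_eq (char_exponent Q xi rho) x y))%:E
     <= (2^-1 * `|complex.Re (pairing (Q x) y)|)%:E
        + 16%:E * codifference_integral xi rho p c
            (fun z => complex.Re (pairing z x))
            (fun z => complex.Re (pairing z y)))%E
  /\
  ((Normc.normc (codifference_ne (char_exponent Q xi rho) x y))%:E
     <= (2^-1 * `|complex.Im (pairing (Q x) y)|)%:E
        + 16%:E * codifference_integral xi rho p c
            (fun z => complex.Re (pairing z x))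
            (fun z => complex.Im (pairing z y)))%E.
Proof.
have [Qsym _ _] := Q_cov.
have bound v := char_exponent_second_difference_le Qsym rho_levy xi_int c
  p_ge0 p_le2 x v.
have ReN (w : R[i]) : complex.Re (- w) = - complex.Re w by case: w.
have Re_i (w : R[i]) : complex.Re (Complex 0 1 * w) = - complex.Im w.
  by case: w => a b /=; rewrite mul0r mul1r sub0r.
split.
  have := bound (- y); rewrite pairingN ReN normrN.
  rewrite (@eq_codifference_integral _ _ _ _ _ _ _
    (fun z => complex.Re (pairing z y)))//.
  by move=> z; rewrite pairingN ReN.
have := bound (Complex 0 1 *: y); rewrite pairingZ Re_i normrN.
rewrite (@eq_codifference_integral _ _ _ _ _ _ _
    (fun z => complex.Im (pairing z y)))//.
by move=> z; rewrite pairingZ Re_i.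
Qed.
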